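(* One has $$\liminf_{X\to\infty}\frac{\#\{m\le X:\ m\ge 2,\ q(\mathcal{V}_m)>1\}}{X}\ \ge\ \frac{47}{210}.$$ Moreover, every integer $m\ge2$ with $q(\mathcal{V}_m)>1$ satisfies $$q(\mathcal{V}_m)-1>\frac{\log(3/2)}{(m+1)\log2}.$$
   Context: For $m\ge2$, $\mathcal{V}_m=(1,2^m-1,2^m)$. For a triple $(a,b,c)$ of positive integers with $a+b=c$, the quality is $q(a,b,c)=\log c/\log\mathrm{rad}(abc)$, where $\mathrm{rad}(n)$ is the product of the distinct primes dividing $n$. *)

(* Defs.v *)
From mathcomp Require Import all_boot all_order all_algebra finmap.
From mathcomp Require Import all_classical all_reals all_analysis.

Set Implicit Arguments.
Unset Strict Implicit.
Unset Printing Implicit Defensive.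

Import Order.TTheory GRing.Theory Num.Theory.
Import numFieldNormedType.Exports.

Local Open Scope classical_set_scope.
Local Open Scope ring_scope.

Definition rad (n : nat) : nat := (\prod_(p <- primes n) p)%N.

Definition abc_triple (t : nat * nat * nat) : Prop :=
  let: (a, b, c) := t in [/\ (0 < a)%N, (0 < b)%N, (0 < c)%N & (a + b = c)%N].

(* Meaningful for abc triples only; for these [rad (a * b * c)] is at least 2,
   so that the denominator is positive. *)
Definition quality (R : realType) (t : nat * nat * nat) : R :=
  let: (a, b, c) := t in ln c%:R / ln (rad (a * b * c)%N)%:R.

Definition Vtriple (m : nat) : nat * nat * nat := (1%N, (2 ^ m - 1)%N, (2 ^ m)%N).

Lemma Vtriple_abc (m : nat) : (2 <= m)%N -> abc_triple (Vtriple m).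
Proof.
move=> m2; split=> //; last by rewrite subnKC// expn_gt0.
- by rewrite subn_gt0 -{1}(expn0 2) ltn_exp2l// ltnW.
- by rewrite expn_gt0.
Qed.

Definition goodV (R : realType) (X : R) : set nat :=
  [set m | [/\ m%:R <= X, (2 <= m)%N & 1 < quality R (Vtriple m)]].

(* [fset_set] returns the empty set on infinite sets, so finiteness matters. *)
Lemma finite_goodV (R : realType) (X : R) : finite_set (goodV X).
Proof.
apply: (@sub_finite_set _ _ `I_(Num.bound `|X|).+1); last exact: finite_II.
move=> m [mX m2 _] /=; rewrite ltnS -(ler_nat R).
apply: (le_trans mX); apply: (le_trans (ler_norm X)).
by apply/ltW/archi_boundP.
Qed.

Definition count_goodV (R : realType) (X : R) : nat := #|` fset_set (goodV X)|%fset.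

(* Main.v *)
Require Import Defs.
From mathcomp Require Import all_boot all_order all_algebra finmap.
From mathcomp Require Import all_classical all_reals all_analysis.
From mathcomp Require Import zify lra.

(** The quality of [(1, 2 ^ m - 1, 2 ^ m)] exceeds 1 exactly when
    [2 * rad (2 ^ m - 1) < 2 ^ m], and this happens exactly when [2 ^ m - 1] is
    not squarefree. Indeed a squarefree [2 ^ m - 1] equals its radical, whose
    double is at least [2 ^ m]; and if [p ^ 2] divides [2 ^ m - 1], then the
    radical is at most [(2 ^ m - 1) / p] ([mul_rad_le]).

    The gap: the prime [p] is odd, hence at least 3, so the radical of the
    triple is below [2/3 * 2 ^ m]. Taking logarithms gives [quality_gap].

    The density: [2 ^ m - 1] is divisible by 9, 25 or 49 as soon as [m] is a
    multiple of the order of 2 modulo that square, namely 6, 20 or 21. The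
    multiples of 6, 20 or 21 are periodic modulo 420 with 94 of them in each
    period ([count_order_multiple]), so their density is [94 / 420 = 47 / 210],
    and an incomplete last period costs only [O(1 / X)] ([goodV_density_ge]). *)

Set Implicit Arguments.
Unset Strict Implicit.
Unset Printing Implicit Defensive.

Import Order.TTheory GRing.Theory Num.Theory.
Import numFieldNormedType.Exports.
Import Defs.

Local Open Scope classical_set_scope.
Local Open Scope ring_scope.

Lemma prod_primes_logn (n : nat) : (0 < n)%N ->
  n = (\prod_(p <- primes n) p ^ logn p n)%N.
Proof. by move=> /prod_prime_decomp {1}->; rewrite prime_decompE big_map. Qed.

Lemma rad_gt0 (n : nat) : (0 < rad n)%N.
Proof.
rewrite /rad big_seq; apply: prodn_cond_gt0 => p.
by rewrite mem_primes => /andP[/prime_gt0].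
Qed.

Lemma rad_le (n : nat) : (0 < n)%N -> (rad n <= n)%N.
Proof.
move=> n0; rewrite [leqRHS](prod_primes_logn n0) /rad !big_seq.
apply: leq_prod => p pn; rewrite -[leqLHS]expn1.
have /andP[pp _] : prime p && (0 < n)%N && (p %| n)%N.
  by move: pn; rewrite mem_primes andbA.
by rewrite leq_exp2l ?prime_gt1 ?logn_gt0//; case/andP: pp.
Qed.

(** Dividing [n] by [p] keeps all its primes when [p ^ 2] divides [n], so that
    [rad n = rad (n / p)], and a radical is at most the number itself. *)
Lemma mul_rad_le (p n : nat) : prime p -> (0 < n)%N -> (p ^ 2 %| n)%N ->
  (p * rad n <= n)%N.
Proof.
move=> pp n0 /dvdnP[k nE].
have k0 : (0 < k)%N by move: n0; rewrite nE muln_gt0 => /andP[].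
have p0 := prime_gt0 pp.
have -> : rad n = rad (p * k).
  rewrite /rad; congr (\prod_(q <- _) q)%N; apply/eq_primes => q.
  rewrite nE [in LHS]primesM ?expn_gt0 ?p0 ?k0// primesX//.
  by rewrite [in RHS]primesM// orbC.
rewrite nE mulnC -[(p ^ 2)%N]/(p * p)%N mulnA (mulnC k) leq_mul2r.
by rewrite rad_le ?orbT// muln_gt0 p0.
Qed.

(** If no prime occurs twice in the factorization of [n], then the product
    defining [rad n] is this factorization. *)
Lemma square_dvdn_of_rad_lt (n : nat) : (0 < n)%N -> (rad n < n)%N ->
  exists2 p, prime p & (p ^ 2 %| n)%N.
Proof.
move=> n0; have [/hasP[p pn l2] _|/hasPn sqf] :=
  boolP (has (fun p => 2 <= logn p n)%N (primes n)).
  exists p; last by rewrite pfactor_dvdn//; move: pn; rewrite mem_primes => /andP[].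
  by move: pn; rewrite mem_primes => /andP[].
suff <- : n = rad n by rewrite ltnn.
rewrite {1}(prod_primes_logn n0) /rad !big_seq; apply: eq_bigr => p pn.
have /eqP-> : logn p n == 1%N; last by rewrite expn1.
by rewrite eqn_leq logn_gt0 pn andbT leqNgt sqf.
Qed.

Lemma radM (a b : nat) : (0 < a)%N -> (0 < b)%N -> coprime a b ->
  rad (a * b) = (rad a * rad b)%N.
Proof.
move=> a0 b0 ab; rewrite /rad -big_cat; apply: perm_big.
apply: uniq_perm; first exact: primes_uniq.
  rewrite cat_uniq !primes_uniq andbT /=.
  by rewrite -coprime_has_primes // hasC in ab *.
by move=> p; rewrite primesM// mem_cat.
Qed.

Lemma rad_Vtriple (m : nat) : (0 < m)%N ->
  rad (1 * (2 ^ m - 1) * 2 ^ m) = (2 * rad (2 ^ m - 1))%N.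
Proof.
case: m => // m _; have lt1 : (1 < 2 ^ m.+1)%N by rewrite -{1}(expn0 2) ltn_exp2l.
rewrite mul1n radM ?subn_gt0 ?(ltnW lt1)//; last first.
  by rewrite coprime_sym subn1 coprimenP// ltnW.
by rewrite mulnC /rad primesX// primes_prime// big_seq1.
Qed.

(** Both logarithms are positive, so the quality exceeds 1 exactly when
    [c > rad (a * b * c)]; the prime 2 contributes the factor 2 here because
    [2 ^ m - 1] is odd. *)
Lemma quality_gt1E (R : realType) (m : nat) : (2 <= m)%N ->
  (1 < quality R (Vtriple m)) = (2 * rad (2 ^ m - 1) < 2 ^ m)%N.
Proof.
move=> m2; rewrite /quality /Vtriple (rad_Vtriple (ltnW m2)).
have r0 := rad_gt0 (2 ^ m - 1).
rewrite ltr_pdivlMr; last by rewrite ln_gt0// ltr1n; lia.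
by rewrite mul1r ltr_ln ?posrE ?ltr0n ?expn_gt0 ?muln_gt0 ?r0// ltr_nat.
Qed.

Lemma mersenne_odd (m : nat) : (0 < m)%N -> odd (2 ^ m - 1).
Proof. by case: m => // m _; rewrite oddB ?expn_gt0// expnS oddM. Qed.

(** Since [p >= 2], a square factor already makes [2 * rad (2 ^ m - 1)] at most
    [2 ^ m - 1]. *)
Lemma quality_gt1 (R : realType) (m p : nat) : (2 <= m)%N -> prime p ->
  (p ^ 2 %| 2 ^ m - 1)%N -> 1 < quality R (Vtriple m).
Proof.
move=> m2 pp pm; rewrite quality_gt1E//.
have m0 : (0 < 2 ^ m)%N by rewrite expn_gt0.
have M0 : (0 < 2 ^ m - 1)%N by case: (2 ^ m - 1)%N (mersenne_odd (ltnW m2)).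
have := mul_rad_le pp M0 pm; have := prime_gt1 pp; nia.
Qed.

(** A squarefree [2 ^ m - 1] would be its own radical and at least [2 ^ m / 2];
    hence some [p ^ 2] divides it, and [p >= 3] by oddness. This turns the bare
    inequality into a gap by the factor 3/2, the source of [ln (3 / 2)]. *)
Lemma rad_mersenne_le (m : nat) : (2 <= m)%N ->
  (2 * rad (2 ^ m - 1) < 2 ^ m)%N -> (3 * rad (2 ^ m - 1) <= 2 ^ m - 1)%N.
Proof.
move=> m2 lt; have od := mersenne_odd (ltnW m2).
have m4 : (4 <= 2 ^ m)%N by rewrite -[4%N]/(2 ^ 2)%N leq_exp2l.
have M0 : (0 < 2 ^ m - 1)%N by lia.
have [|p pp pm] := square_dvdn_of_rad_lt M0; first by lia.
apply: leq_trans (mul_rad_le pp M0 pm); rewrite leq_mul2r; apply/orP; right.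
apply: odd_prime_gt2 => //; apply: dvdn_odd od.
by apply: dvdn_trans pm; rewrite expnS dvdn_mulr.
Qed.

(** With [c = 2 ^ m] and [r = rad (a * b * c)], the quality minus 1 is
    [ln (c / r) / ln r], where [c / r > 3 / 2] by [rad_mersenne_le] and
    [ln r < (m + 1) * ln 2] because [r < c]. *)
Lemma quality_gap (R : realType) (m : nat) : (2 <= m)%N ->
  1 < quality R (Vtriple m) ->
  ln (3%:R / 2%:R) / ((m.+1)%:R * ln 2%:R) < quality R (Vtriple m) - 1.
Proof.
move=> m2; rewrite quality_gt1E// => lt; have := rad_mersenne_le m2 lt.
rewrite /quality /Vtriple (rad_Vtriple (ltnW m2)).
have := rad_gt0 (2 ^ m - 1); set r := (2 * _)%N in lt * => r0 r3.
have r2 : (2 <= r)%N by rewrite /r; lia.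
have rc : (3 * r < 2 * 2 ^ m)%N by rewrite /r; lia.
have {}r0 : 0 < r%:R :> R by rewrite ltr0n; lia.
have lr : 0 < ln r%:R :> R by rewrite ln_gt0// ltr1n.
have l32 : 0 < ln (3%:R / 2%:R) :> R by rewrite ln_gt0//; lra.
have lrm : ln r%:R < m.+1%:R * ln 2%:R :> R.
  rewrite mulr_natl -lnXn// -natrX ltr_ln ?posrE ?ltr0n ?expn_gt0//; last by lia.
  by rewrite ltr_nat expnS; lia.
have num : ln (3%:R / 2%:R) + ln r%:R < ln (2 ^ m)%:R :> R.
  rewrite -lnM ?posrE//.
  rewrite ltr_ln ?posrE ?ltr0n ?expn_gt0 ?mulr_gt0//.
  have : (3 * r)%:R < (2 * 2 ^ m)%:R :> R by rewrite ltr_nat.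
  by rewrite !natrM; lra.
have -> : ln (2 ^ m)%:R / ln r%:R - 1 = (ln (2 ^ m)%:R - ln r%:R) / ln r%:R :> R.
  by rewrite mulrBl divff// gt_eqF.
apply: (@lt_trans _ _ (ln (3%:R / 2%:R) / ln r%:R)).
  by rewrite ltr_pM2l// ltf_pV2 ?posrE// (lt_trans lr).
by rewrite ltr_pM2r ?invr_gt0// ltrBrDr.
Qed.

(** The moduli are the multiplicative orders of 2 modulo 9, 25 and 49. *)
Definition order_multiple (m : nat) : bool :=
  [|| 6 %| m, 20 %| m | 21 %| m]%N.

Lemma dvdn_expB1 (d a k : nat) : (a %| k)%N -> 2 ^ a = 1 %[mod d] ->
  (d %| 2 ^ k - 1)%N.
Proof.
move=> /dvdnP[j ->] e; rewrite -eqn_mod_dvd ?expn_gt0//.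
by rewrite mulnC expnM -modnXm e modnXm exp1n.
Qed.

(** Reducing at an intermediate power keeps the unary computation small. *)
Lemma expn2_20_mod25 : 2 ^ 20 = 1 %[mod 25].
Proof. by rewrite -[20%N]/(10 * 2)%N expnM -modnXm. Qed.

Lemma expn2_21_mod49 : 2 ^ 21 = 1 %[mod 49].
Proof. by rewrite -[21%N]/(7 * 3)%N expnM -modnXm. Qed.

Lemma order_multiple_quality_gt1 (R : realType) (m : nat) : (0 < m)%N ->
  order_multiple m -> 1 < quality R (Vtriple m).
Proof.
move=> m0 /or3P[] dm; have m2 : (2 <= m)%N by apply: leq_trans (dvdn_leq m0 dm).
- by apply: (@quality_gt1 _ _ 3) => //; apply: dvdn_expB1 dm _.
- by apply: (@quality_gt1 _ _ 5) => //; apply: dvdn_expB1 dm _; apply: expn2_20_mod25.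
- by apply: (@quality_gt1 _ _ 7) => //; apply: dvdn_expB1 dm _; apply: expn2_21_mod49.
Qed.

(** The property is periodic with period [420 = lcm(6, 20, 21)], and one period
    contains [70 + 21 + 20 - 7 - 10 - 1 + 1 = 94] such integers by
    inclusion-exclusion. *)
Lemma count_order_multiple (k : nat) :
  count order_multiple (iota 1 (420 * k)) = (94 * k)%N.
Proof.
elim: k => // k IH; rewrite !mulnS addnC iotaD count_cat IH addnC.
congr addn; rewrite addnC iotaDl count_map.
(* The remaining period is counted by evaluation. *)
rewrite (@eq_count _ _ order_multiple)//.
move=> m /=; rewrite /order_multiple.
have period d : (d %| 420)%N -> (d %| 420 * k + m)%N = (d %| m)%N.
  by move=> d420; rewrite dvdn_addr// dvdn_mulr.
by rewrite !period.
Qed.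

Lemma count_goodV_ge (R : realType) (X : R) (k : nat) : (420 * k)%:R <= X ->
  (94 * k <= count_goodV X)%N.
Proof.
move=> kX; rewrite -count_order_multiple -size_filter.
apply: uniq_leq_size; first by rewrite filter_uniq// iota_uniq.
move=> m; rewrite mem_filter mem_iota => /and3P[good m0 mk].
rewrite in_fset_set; last exact: finite_goodV.
have q := order_multiple_quality_gt1 R m0 good.
rewrite inE /goodV /=; split => //.
  by apply: le_trans kX; rewrite ler_nat -ltnS -add1n.
(* Only [m = 1] is left to exclude, and it is a multiple of none of the orders. *)
by case: m good m0 {q mk} => [|[|]].
Qed.

(** Counting only the complete periods below [X] loses less than one period,
    that is at most 94 integers; and [94 / 420 = 47 / 210]. *)
Lemma goodV_density_ge (R : realType) (X : R) : 0 < X ->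
  47%:R / 210%:R - 94%:R / X <= (count_goodV X)%:R / X.
Proof.
move=> X0; rewrite ler_pdivlMr// mulrBl divfK ?gt_eqF//.
have c0 : 0 < 420%:R :> R by rewrite ltr0n.
have /truncn_itv/andP[] : 0 <= X / 420%:R by rewrite mulr_ge0 ?invr_ge0 ?ltW.
set k := Num.truncn _; rewrite ler_pdivlMr ?ltr_pdivrMr ?c0// => kX Xk.
have /count_goodV_ge : (420 * k)%:R <= X by rewrite mulnC natrM.
rewrite -(ler_nat R); apply: le_trans; rewrite natrM.
move: Xk; rewrite -natr1; lra.
Qed.

Theorem corollary6p20 (R : realType) :
  ((47%:R / 210%:R : R)%:E <=
     limf_einf (fun X : R => ((count_goodV X)%:R / X)%:E) (pinfty_nbhs R))%E
  /\
  forall m : nat, (2 <= m)%N -> 1 < quality R (Vtriple m) ->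
    ln (3%:R / 2%:R) / ((m.+1)%:R * ln 2%:R) < quality R (Vtriple m) - 1.
Proof.
split; last exact: quality_gap.
rewrite limf_einfE; apply/lee_subgt0Pr => e e0.
(* On the neighbourhood [X > 94 / e] of infinity, the error term is below [e]. *)
apply: (@le_trans _ _ (ereal_inf
    [set ((count_goodV X)%:R / X)%:E | X in [set X : R | 94%:R / e < X]])).
  apply/ereal_infP => _ [X /= eX <-].
  have X0 : 0 < X by apply: le_lt_trans eX; rewrite divr_ge0// ltW.
  rewrite lee_fin; apply: le_trans (goodV_density_ge X0).
  by rewrite lerB// ler_pdivrMr// mulrC -ler_pdivrMr// ltW.
apply: ereal_sup_ubound; exists [set X : R | 94%:R / e < X] => //.
by exists (94%:R / e); split => //; rewrite num_real.
Qed.
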